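(* Let $w,v$ be infinite binary words. (1) For all $n\ge1$, $\psi_w(n)=P_{w'}(n)-P_{w''}(n)+1$, where $w'=\mathrm{PNF}_1(w)$ and $w''=\mathrm{PNF}_0(w)$. (2) $\Pi(w)=\Pi(v)$ if and only if $\mathrm{PNF}_0(w)=\mathrm{PNF}_0(v)$ and $\mathrm{PNF}_1(w)=\mathrm{PNF}_1(v)$.
   Context: Binary words are indexed from $1$; $P_w(i)$ is the number of $1$s in the prefix of length $i$ of $w$. For a finite word $u$, its Parikh vector is $pv(u)=(|u|_0,|u|_1)$ (numbers of $0$s and $1$s). $\Pi(w)=\{pv(u): u \text{ a factor of } w\}$, and the abelian complexity is $\psi_w(n)=|\{pv(u): u \text{ a factor of } w,\ |u|=n\}|$. $F^1_w(i)$ (resp. $F^0_w(i)$) is the maximum number of $1$s (resp. $0$s) in a factor of $w$ of length $i$, with $F^a_w(0)=0$. The prefix normal forms are the infinite words $\mathrm{PNF}_1(w)=w'$, $\mathrm{PNF}_0(w)=w''$ with $w'_n=F^1_w(n)-F^1_w(n-1)$ and $w''_n=1-(F^0_w(n)-F^0_w(n-1))$ for $n\ge1$. *)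

(* Defs.v *)
From mathcomp Require Import all_boot all_order all_algebra finmap.
From mathcomp Require Import boolp classical_sets cardinality.

Set Implicit Arguments.
Unset Strict Implicit.
Unset Printing Implicit Defensive.

Import GRing.Theory.
Local Open Scope classical_set_scope.
Local Open Scope ring_scope.

(** The letter 1 is [true], the letter 0 is [false]. Words are written with
    indices starting from 1: the letter w_n, n >= 1, is [w n.-1]. *)
Definition infword := nat -> bool.

Definition prefix_ones (w : infword) (i : nat) : nat :=
  count_mem true (mkseq w i).

Definition factor_at (w : infword) (j n : nat) : seq bool :=
  mkseq (fun k => w (j + k)%N) n.

Definition is_factor (w : infword) (u : seq bool) : Prop :=
  exists j, u = factor_at w j (size u).

Definition parikh (u : seq bool) : nat * nat :=
  (count_mem false u, count_mem true u).

Definition parikh_set (w : infword) : set (nat * nat) :=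
  parikh @` [set u | is_factor w u].

(** [fset_set] is meaningful on finite sets only; see [finite_parikh] below. *)
Definition abelian_complexity (w : infword) (n : nat) : nat :=
  #|` fset_set (parikh @` [set u | is_factor w u /\ size u = n]) |.

(** The maximum is over a nonempty finite set, so it is attained; for [i = 0]
    the only factor is the empty word and the value is 0. *)
Definition maxocc (a : bool) (w : infword) (i : nat) : nat :=
  \max_(u : i.-tuple bool | `[< is_factor w u >]) count_mem a u.

(** A letter is the boolean test that the defining formula, which takes its
    values in {0, 1} (see [PNF1E] and [PNF0E] below), is equal to 1. *)
Definition PNF1 (w : infword) : infword := fun n =>
  (maxocc true w n.+1)%:Z - (maxocc true w n)%:Z == 1.

Definition PNF0 (w : infword) : infword := fun n =>
  1 - ((maxocc false w n.+1)%:Z - (maxocc false w n)%:Z) == 1.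

Lemma finite_parikh (w : infword) (n : nat) :
  finite_set (parikh @` [set u | is_factor w u /\ size u = n]).
Proof.
apply: finite_image.
apply: (@sub_finite_set _ _ ((@tval n bool) @` setT)).
  by move=> u [_ /eqP su]; exists (Tuple su).
exact/finite_image/finite_finset.
Qed.

Lemma maxocc0 a w : maxocc a w 0 = 0%N.
Proof. by rewrite /maxocc big1 // => u _; rewrite tuple0. Qed.

Lemma is_factor_at w j n : is_factor w (factor_at w j n).
Proof. by exists j; rewrite size_mkseq. Qed.

Lemma count_factor_le a w j n : (count_mem a (factor_at w j n) <= maxocc a w n)%N.
Proof.
have sz : size (factor_at w j n) == n by rewrite size_mkseq.
have fu : `[< is_factor w (Tuple sz) >] by apply/asboolP; exact: is_factor_at.
exact: (@leq_bigmax_cond _ (fun u : n.-tuple bool => `[< is_factor w u >])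
  (fun u => count_mem a u) (Tuple sz) fu).
Qed.

Lemma maxocc_attained a w n : exists j, maxocc a w n = count_mem a (factor_at w j n).
Proof.
have sz : size (factor_at w 0 n) == n by rewrite size_mkseq.
have fu : `[< is_factor w (Tuple sz) >] by apply/asboolP; exact: is_factor_at.
have [|u /asboolP [j uj] eu] := @eq_bigmax_cond _
    (fun u : n.-tuple bool => `[< is_factor w u >]) (fun u => count_mem a u).
  by apply/card_gt0P; exists (Tuple sz).
rewrite size_tuple in uj.
by exists j; rewrite -uj -eu.
Qed.

Lemma factor_atS w j n : factor_at w j n.+1 = rcons (factor_at w j n) (w (j + n)%N).
Proof. by rewrite /factor_at /mkseq -addn1 iotaD map_cat /= cats1. Qed.

Lemma count_factor_atS a w j n : count_mem a (factor_at w j n.+1) =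
  (count_mem a (factor_at w j n) + (w (j + n)%N == a))%N.
Proof. by rewrite factor_atS -cats1 count_cat /= addn0. Qed.

Lemma maxoccS a w n : (maxocc a w n <= maxocc a w n.+1 <= (maxocc a w n).+1)%N.
Proof.
apply/andP; split.
  have [j ->] := maxocc_attained a w n.
  apply: leq_trans (count_factor_le a w j n.+1).
  by rewrite count_factor_atS leq_addr.
have [j ->] := maxocc_attained a w n.+1.
rewrite count_factor_atS -addn1 leq_add ?count_factor_le //.
by case: (_ == _).
Qed.

Lemma maxoccS_eq a w n :
  maxocc a w n.+1 = maxocc a w n \/ maxocc a w n.+1 = (maxocc a w n).+1.
Proof.
have /andP[le1 le2] := maxoccS a w n.
move: le2; rewrite leq_eqVlt ltnS => /orP[/eqP ->|le2]; first by right.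
by left; apply/eqP; rewrite eqn_leq le1 le2.
Qed.

Lemma PNF1E w n :
  (PNF1 w n)%:Z = (maxocc true w n.+1)%:Z - (maxocc true w n)%:Z.
Proof.
by rewrite /PNF1; case: (maxoccS_eq true w n) => ->;
  rewrite ?subrr // intS addrK.
Qed.

Lemma PNF0E w n :
  (PNF0 w n)%:Z = 1 - ((maxocc false w n.+1)%:Z - (maxocc false w n)%:Z).
Proof.
by rewrite /PNF0; case: (maxoccS_eq false w n) => ->;
  rewrite ?subrr // intS addrK.
Qed.

(* Main.v *)
Require Import Defs.
From mathcomp Require Import all_boot all_order all_algebra.
From mathcomp Require Import boolp classical_sets cardinality.
From mathcomp Require Import finmap zify.

(** Sliding a window of length n by one position changes its number of 1s by at
    most one, so the numbers of 1s of the factors of length n fill the whole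
    interval between n - F^0(n) and F^1(n). Hence (a, b) is a Parikh vector of w
    iff a <= F^0(a + b) and b <= F^1(a + b). The endpoints of the interval are
    the prefix sums of the two prefix normal forms, which determine and are
    determined by them. *)

Lemma count_false_true (s : seq bool) :
  (count_mem false s + count_mem true s = size s)%N.
Proof.
by rewrite -(count_predC (pred1 true) s) addnC; congr addn; apply: eq_count; case. Qed.

(** Bounding the upward steps is enough. Induct on the right end: if [k] exceeds [g j], then
    [g j < k <= g j.+1 <= (g j).+1] forces [k = g j.+1]. *)
Lemma nat_discrete_ivt (g : nat -> nat) (i j k : nat) :
  (forall l, g l.+1 <= (g l).+1)%N -> (i <= j)%N -> (g i <= k <= g j)%N ->
  exists l, g l = k.
Proof.
move=> gS; elim: j => [|j IH] ij /andP[gik kgj].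
  by exists 0%N; have i0 : i = 0%N by [lia]; subst i; lia.
have [eij|nij] := eqVneq i j.+1; first by exists i; subst i; lia.
have [le|lt] := leqP k (g j); first by apply: IH; lia.
by exists j.+1; have := gS j; lia.
Qed.

(** For nonempty windows, the two overlap in all but one letter each: the first letter of the left
    one and the last letter of the right one. *)
Lemma count_factor_shift (a : bool) (w : infword) (n j : nat) :
  (count_mem a (factor_at w j.+1 n) <= (count_mem a (factor_at w j n)).+1)%N.
Proof.
elim: n j => [|n IH] j //.
have consE i : factor_at w i n.+1 = w i :: factor_at w i.+1 n.
  rewrite /factor_at /mkseq /= addn0 (iotaDl 1 0) -map_comp.
  by congr (_ :: _); apply: eq_map => l /=; rewrite add1n addSnnS.
rewrite count_factor_atS consE /=; lia.
Qed.

Lemma parikh_factor_exists (w : infword) (a b : nat) :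
  (a <= maxocc false w (a + b))%N -> (b <= maxocc true w (a + b))%N ->
  exists j, parikh (factor_at w j (a + b)) = (a, b).
Proof.
have cE j : (count_mem false (factor_at w j (a + b)) +
             count_mem true (factor_at w j (a + b)) = a + b)%N.
  by rewrite count_false_true size_mkseq.
have [i ->] := maxocc_attained false w (a + b).
have [j ->] := maxocc_attained true w (a + b).
move=> ai bj; have ci := cE i; have cj := cE j.
have shift c := count_factor_shift c w (a + b).
(* The window at [i] is richest in 0s, the one at [j] in 1s. Sliding rightwards from the earlier to
   the later, the letter in which the later one is richest passes through its target count; the
   fixed length gives the other count. *)
case: (leqP i j) => [ij|/ltnW ji].
  have [|l El] := @nat_discrete_ivt _ i j b (shift true) ij; first lia.
  by exists l; have := cE l; rewrite /parikh El => /addIn ->.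
have [|l El] := @nat_discrete_ivt _ j i a (shift false) ji; first lia.
by exists l; have := cE l; rewrite /parikh El => /addnI ->.
Qed.

Lemma parikh_setP (w : infword) (a b : nat) :
  parikh_set w (a, b) <->
  (a <= maxocc false w (a + b))%N /\ (b <= maxocc true w (a + b))%N.
Proof.
split=> [[u [j ->]] [<- <-]|[ha hb]].
  by rewrite count_false_true size_mkseq; split; apply: count_factor_le.
have [j pj] := @parikh_factor_exists w a b ha hb.
by exists (factor_at w j (a + b)) => //; apply: is_factor_at.
Qed.

(** A factor of [w] attaining the maximum has a Parikh vector with coordinate sum [n], so its
    membership for [v] bounds the [c]-coordinate. *)
Lemma maxocc_le_of_parikh_sub (w v : infword) (c : bool) (n : nat) :
  (forall p, parikh_set w p -> parikh_set v p) ->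
  (maxocc c w n <= maxocc c v n)%N.
Proof.
move=> sub; have [j ->] := maxocc_attained c w n.
have : parikh_set w (parikh (factor_at w j n)).
  by exists (factor_at w j n) => //; apply: is_factor_at.
move=> /sub /parikh_setP; rewrite count_false_true size_mkseq.
by case: c => -[].
Qed.

Lemma prefix_onesS (w : infword) (n : nat) :
  prefix_ones w n.+1 = (prefix_ones w n + w n)%N.
Proof. by rewrite /prefix_ones (count_factor_atS true w 0 n) /= eqb_id. Qed.

Lemma prefix_ones_PNF1 (w : infword) (n : nat) :
  prefix_ones (PNF1 w) n = maxocc true w n.
Proof.
elim: n => [|n IH]; first by rewrite maxocc0.
by rewrite prefix_onesS IH; have := PNF1E w n; lia.
Qed.

(** The 0s of [PNF0 w] mark the increments of the maximum, so the maximum counts the 0s of the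
    prefix. *)
Lemma prefix_ones_PNF0 (w : infword) (n : nat) :
  (prefix_ones (PNF0 w) n + maxocc false w n = n)%N.
Proof.
elim: n => [|n IH]; first by rewrite maxocc0.
by rewrite prefix_onesS; have := PNF0E w n; lia.
Qed.

Lemma abelian_complexityE (w : infword) (n : nat) :
  (abelian_complexity w n + n = maxocc true w n + maxocc false w n + 1)%N.
Proof.
(* The next three bounds make the natural-number subtractions in [s] exact. *)
have len : (n <= maxocc true w n + maxocc false w n)%N.
  have := count_factor_le true w 0 n; have := count_factor_le false w 0 n.
  by have := count_false_true (factor_at w 0 n); rewrite size_mkseq; lia.
have leF : (maxocc false w n <= n)%N by rewrite -{2}(prefix_ones_PNF0 w n) leq_addl.
have leT : (maxocc true w n <= n)%N.
  by have [j ->] := maxocc_attained true w n;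
     rewrite -{2}(size_mkseq (fun k => w (j + k)%N) n) count_size.
(* The Parikh vectors of length [n], listed by their number [k] of 1s. *)
pose s := [seq ((n - k)%N, k) | k <- iota (n - maxocc false w n)
                               (maxocc true w n + maxocc false w n - n).+1].
have us : uniq s by rewrite map_inj_uniq ?iota_uniq // => x y [].
rewrite /abelian_complexity.
have -> : (parikh @` [set u | is_factor w u /\ size u = n] =
         [set` [fset x in s]%fset])%classic.
  apply/seteqP; split=> [p [u [[j ->]]]|[a b]] /=.
    rewrite size_mkseq => -> <-; rewrite in_fset /=; apply/mapP.
    have := count_factor_le true w j n; have := count_factor_le false w j n.
    have := count_false_true (factor_at w j n); rewrite size_mkseq => E hf ht.
    exists (count_mem true (factor_at w j n)); first by rewrite mem_iota; lia.
    by rewrite /parikh; congr pair; lia.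
  rewrite in_fset => /mapP[k]; rewrite mem_iota => hk [-> ->].
  have E : (n - k + k = n)%N by lia.
  have [||j] := @parikh_factor_exists w (n - k) k; rewrite E; [lia|lia|move=> pj].
  by exists (factor_at w j n) => //; split; [exact: is_factor_at|rewrite size_mkseq].
by rewrite set_fsetK card_fseq undup_id // size_map size_iota; lia.
Qed.

Theorem theorem3 (w v : infword) :
  (forall n : nat, (1 <= n)%N ->
     ((abelian_complexity w n)%:Z =
      (prefix_ones (PNF1 w) n)%:Z - (prefix_ones (PNF0 w) n)%:Z + 1)%R)
  /\ (parikh_set w = parikh_set v <-> (PNF0 w = PNF0 v /\ PNF1 w = PNF1 v)).
Proof.
split=> [n _|].
  rewrite prefix_ones_PNF1.
  by have := prefix_ones_PNF0 w n; have := abelian_complexityE w n; lia.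
split=> [E|[E0 E1]].
  have EF c n : maxocc c w n = maxocc c v n.
    by apply/eqP; rewrite eqn_leq !maxocc_le_of_parikh_sub // E.
  by split; apply/funext => n; rewrite /PNF0 /PNF1 !EF.
(* Prefix sums of the normal forms recover the maxima, which decide membership. *)
have EF c n : maxocc c w n = maxocc c v n.
  case: c; first by rewrite -!prefix_ones_PNF1 E1.
  by have := prefix_ones_PNF0 w n; have := prefix_ones_PNF0 v n; rewrite E0; lia.
by apply/seteqP; split=> -[a b] /parikh_setP H; apply/parikh_setP; move: H; rewrite !EF.
Qed.
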